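(* Let $n\ge 1$ and let $X_n=\mathbb R^n\cup\{\infty\}$ be the one-point compactification of $\mathbb R^n$, with the action of $\mathrm{GL}(n,\mathbb R)$ extending the linear action $\mathrm{GL}(n,\mathbb R)\times\mathbb R^n\to\mathbb R^n$ and fixing $\infty$. Then the dynamical system $(X_n,\mathrm{GL}(n,\mathbb R))$ is tame, but for $n\ge 2$ it is not tame$_{\mathbf 1}$.
   Context: For a topological group $T$ acting continuously on a compact metrizable space $X$, the enveloping semigroup $E(X,T)$ is the closure of the set of translations $\{x\mapsto tx:t\in T\}$ in $X^X$ with the pointwise topology. The system is tame$_{\mathbf 1}$ if $E(X,T)$ is first countable. A sequence $(f_n)$ of real functions on $X$ is independent if there are reals $a<b$ such that $\bigcap_{n\in P}f_n^{-1}((-\infty,a))\cap\bigcap_{n\in M}f_n^{-1}((b,\infty))\neq\emptyset$ for all finite disjoint $P,M\subset\mathbb N$. The system is tame if for every continuous $f\colon X\to\mathbb R$ the family $\{f\circ t:t\in T\}$ contains no infinite independent sequence. *)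

(* Defs.v *)
From HB Require Import structures.
From mathcomp Require Import all_boot all_order all_algebra.
From mathcomp Require Import all_classical all_reals all_analysis.

Set Implicit Arguments.
Unset Strict Implicit.
Unset Printing Implicit Defensive.

Import Order.TTheory GRing.Theory Num.Theory.
Import numFieldNormedType.Exports.

Local Open Scope classical_set_scope.
Local Open Scope ring_scope.

HB.mixin Record isTopologicalGroup G & Topological G & Group G := {
  mulg_continuous : continuous (fun p : G * G => (p.1 * p.2)%g) ;
  invg_continuous : continuous (fun x : G => (x^-1)%g) ;
}.

#[short(type="topologicalGroupType")]
HB.structure Definition TopologicalGroup :=
  {G of Topological G & Group G & isTopologicalGroup G}.

Definition is_metric (R : realType) (X : Type) (d : X -> X -> R) : Prop :=
  [/\ forall x y, 0 <= d x y,
      forall x y, d x y = 0 <-> x = y,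
      forall x y, d x y = d y x &
      forall x y z, d x z <= d x y + d y z].

Definition metrizable (R : realType) (X : topologicalType) : Prop :=
  exists d : X -> X -> R, is_metric d /\
    forall (x : X) (U : set X),
      nbhs x U <-> exists2 e : R, 0 < e & [set y | d x y < e] `<=` U.

Definition first_countable (Y : topologicalType) : Prop :=
  forall y : Y, exists B : nat -> set Y,
    (forall k, nbhs y (B k)) /\ forall U, nbhs y U -> exists k, B k `<=` U.

Record dynamical_system (R : realType) := DynamicalSystem {
  ds_group : topologicalGroupType ;
  ds_space : topologicalType ;
  ds_compact : compact [set: ds_space] ;
  ds_metrizable : metrizable R ds_space ;
  ds_act : ds_group -> ds_space -> ds_space ;
  ds_act1 : forall x, ds_act 1%g x = x ;
  ds_actM : forall s t x, ds_act (s * t)%g x = ds_act s (ds_act t x) ;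
  ds_act_continuous :
    continuous (fun p : ds_group * ds_space => ds_act p.1 p.2)
}.

Section Tameness.
Context {R : realType}.

Definition enveloping_semigroup (S : dynamical_system R) :
    set {ptws ds_space S -> ds_space S} :=
  closure (range (@ds_act R S) : set {ptws ds_space S -> ds_space S}).
Arguments enveloping_semigroup S : clear implicits.

(* [set_type] carries the subspace topology. *)
Definition tame1 (S : dynamical_system R) : Prop :=
  first_countable (set_type (enveloping_semigroup S)).

Definition independent_seq (X : Type) (f : nat -> X -> R) : Prop :=
  exists a b : R, a < b /\
    forall P M : set nat, finite_set P -> finite_set M -> P `&` M = set0 ->
      (\bigcap_(n in P) f n @^-1` [set r | r < a]) `&`
      (\bigcap_(n in M) f n @^-1` [set r | b < r]) !=set0.

Definition tame (S : dynamical_system R) : Prop :=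
  forall f : ds_space S -> R, continuous f ->
    ~ exists g : nat -> ds_space S -> R,
        (forall n, [set f \o ds_act t | t in [set: ds_group S]] (g n)) /\
        independent_seq g.

End Tameness.

Arguments enveloping_semigroup {R} S.

Section GeneralLinearGroup.
Variables (R : realType) (n : nat).

Definition GL : Type := {A : 'M[R]_n | A \in unitmx}.

HB.instance Definition _ := SubChoice.on GL.

Definition GL_mx (A : GL) : 'M[R]_n := sval A.

Lemma GL_mx_unit (A : GL) : GL_mx A \in unitmx.
Proof. exact: valP. Qed.

Definition GL_one : GL := Sub 1%:M (unitmx1 R n).

Fact GL_mul_subproof (A B : GL) : GL_mx A *m GL_mx B \in unitmx.
Proof. by rewrite unitmx_mul (GL_mx_unit A) (GL_mx_unit B). Qed.
Definition GL_mul (A B : GL) : GL :=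
  Sub (GL_mx A *m GL_mx B) (GL_mul_subproof A B).

Fact GL_inv_subproof (A : GL) : invmx (GL_mx A) \in unitmx.
Proof. by rewrite unitmx_inv (GL_mx_unit A). Qed.
Definition GL_inv (A : GL) : GL := Sub (invmx (GL_mx A)) (GL_inv_subproof A).

Fact GL_mulA : associative GL_mul.
Proof. by move=> A B C; apply/val_inj/mulmxA. Qed.
Fact GL_mul1 : left_id GL_one GL_mul.
Proof. by move=> A; apply/val_inj/mul1mx. Qed.
Fact GL_mulr1 : right_id GL_one GL_mul.
Proof. by move=> A; apply/val_inj/mulmx1. Qed.
Fact GL_mulV : left_inverse GL_one GL_inv GL_mul.
Proof. by move=> A; apply/val_inj/mulVmx/(GL_mx_unit A). Qed.
Fact GL_mulVr : right_inverse GL_one GL_inv GL_mul.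
Proof. by move=> A; apply/val_inj/mulmxV/(GL_mx_unit A). Qed.

HB.instance Definition _ := isGroup.Build GL
  GL_mulA GL_mul1 GL_mulr1 GL_mulV GL_mulVr.

HB.instance Definition _ :=
  Topological.copy GL (initial_topology (GL_mx : GL -> 'M[R]_n)).

Lemma GL_mx_continuous : continuous (GL_mx : GL -> 'M[R]_n).
Proof. exact: initial_continuous. Qed.

End GeneralLinearGroup.

Arguments GL_mx {R n} A.

Section Continuity.
Variable R : realType.

Lemma cvg_to_GL n (T : Type) (F : set_system T) (FF : Filter F)
    (f : T -> GL R n) (A : GL R n) :
  (GL_mx \o f) @ F --> GL_mx A -> f @ F --> A.
Proof.
move=> fA U /= [_ [[W oW <-] /= WA WU]].
have : nbhs (GL_mx A) W by apply: open_nbhs_nbhs.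
by move=> /fA; rewrite !nbhs_filterE /= => /filterS; apply=> t Wt; apply: WU.
Qed.

Lemma cvg_mx m n (T : Type) (F : set_system T) (FF : Filter F)
    (f : T -> 'M[R]_(m, n)) (A : 'M[R]_(m, n)) :
  (forall i j, (fun t => f t i j) @ F --> A i j) -> f @ F --> A.
Proof.
move=> fA U [P /= PA PU].
have : \forall t \near F, forall i j, P i j (f t i j).
  by apply: filter_forall => i; apply: filter_forall => j; exact/fA/PA.
by apply: filterS => t Pt; apply: PU.
Qed.

Lemma cvg_sumr (T : Type) (F : set_system T) (FF : Filter F) (I : Type)
    (r : seq I) (f : I -> T -> R) (l : I -> R) :
  (forall i, f i @ F --> l i) ->
  (fun t => \sum_(i <- r) f i t) @ F --> \sum_(i <- r) l i.
Proof.
move=> fl; elim: r => [|i r IH].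
  by rewrite big_nil; under eq_fun do rewrite big_nil; exact: cvg_cst.
by rewrite big_cons; under eq_fun do rewrite big_cons; exact: cvgD.
Qed.

Lemma cvg_prodr (T : Type) (F : set_system T) (FF : Filter F) (I : Type)
    (r : seq I) (f : I -> T -> R) (l : I -> R) :
  (forall i, f i @ F --> l i) ->
  (fun t => \prod_(i <- r) f i t) @ F --> \prod_(i <- r) l i.
Proof.
move=> fl; elim: r => [|i r IH].
  by rewrite big_nil; under eq_fun do rewrite big_nil; exact: cvg_cst.
by rewrite big_cons; under eq_fun do rewrite big_cons; exact: cvgM.
Qed.

Lemma cvg_det n (T : Type) (F : set_system T) (FF : Filter F)
    (f : T -> 'M[R]_n) (A : 'M[R]_n) :
  (forall i j, (fun t => f t i j) @ F --> A i j) ->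
  (fun t => \det (f t)) @ F --> \det A.
Proof.
move=> fA; apply: cvg_sumr => s.
by apply: cvgM; [exact: cvg_cst | exact: cvg_prodr].
Qed.

Lemma cvg_coord m n (T : Type) (F : set_system T) (FF : Filter F)
    (f : T -> 'M[R]_(m, n)) (A : 'M[R]_(m, n)) :
  f @ F --> A -> forall i j, (fun t => f t i j) @ F --> A i j.
Proof.
move=> fA i j.
apply: (@cvg_comp _ _ _ f (fun M : 'M[R]_(m, n) => M i j) _ _ _ fA).
exact: coord_continuous.
Qed.

Lemma cvg_mulmx m n p (T : Type) (F : set_system T) (FF : Filter F)
    (f : T -> 'M[R]_(m, n)) (g : T -> 'M[R]_(n, p))
    (A : 'M[R]_(m, n)) (B : 'M[R]_(n, p)) :
  f @ F --> A -> g @ F --> B -> (fun t => f t *m g t) @ F --> A *m B.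
Proof.
move=> fA gB; apply: cvg_mx => i j; rewrite mxE.
under eq_fun do rewrite mxE.
by apply: cvg_sumr => k; apply: cvgM; exact: cvg_coord.
Qed.

Lemma GL_mul_continuous n :
  continuous (fun p : GL R n * GL R n => (p.1 * p.2)%g).
Proof.
case=> A B; apply: cvg_to_GL; rewrite /comp /=.
apply: cvg_mulmx.
  by apply: (@cvg_comp _ _ _ fst GL_mx); [exact: cvg_fst | exact: GL_mx_continuous].
by apply: (@cvg_comp _ _ _ snd GL_mx); [exact: cvg_snd | exact: GL_mx_continuous].
Qed.

Lemma cvg_invmx n (T : Type) (F : set_system T) (FF : Filter F)
    (f : T -> 'M[R]_n) (A : 'M[R]_n) :
  (forall t, f t \in unitmx) -> A \in unitmx ->
  f @ F --> A -> (fun t => invmx (f t)) @ F --> invmx A.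
Proof.
move=> fu Au fA.
have -> : (fun t => invmx (f t)) = fun t => (\det (f t))^-1 *: \adj (f t).
  by apply/funext => t; rewrite /invmx fu.
rewrite /invmx Au; apply: cvg_mx => i j.
rewrite !mxE; under eq_fun do rewrite !mxE.
apply: cvgM.
  apply: cvgV; first by rewrite -unitfE -unitmxE.
  by apply: cvg_det; exact: cvg_coord.
apply: cvgM; first exact: cvg_cst.
apply: cvg_det => k l; rewrite !mxE; under eq_fun do rewrite !mxE.
exact: cvg_coord.
Qed.

Lemma cvg_entry_bound m n (T : Type) (F : set_system T) (FF : Filter F)
    (f : T -> 'M[R]_(m, n)) (A : 'M[R]_(m, n)) : f @ F --> A ->
  exists c, \forall t \near F, forall i j, `|f t i j| <= c.
Proof.
move=> fA; exists (\sum_i \sum_j (`|A i j| + 1)).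
apply: filter_forall => i; apply: filter_forall => j.
have : (fun t => `|f t i j|) @ F --> `|A i j|.
  by apply: cvg_norm; exact: cvg_coord.
move=> /cvgr_le /(_ (`|A i j| + 1)); rewrite ltrDl => /(_ ltr01).
apply: filterS => t /le_trans; apply.
rewrite (bigD1 i)//= (bigD1 j)//= -addrA lerDl addr_ge0 ?sumr_ge0//.
by move=> k _; rewrite sumr_ge0.
Qed.

Lemma cvg_GL_inv n (A : GL R n) :
  (fun B : GL R n => invmx (GL_mx B)) @ A --> invmx (GL_mx A).
Proof.
exact: (@cvg_invmx n _ (nbhs A) (nbhs_filter A) GL_mx (GL_mx A)
  (@GL_mx_unit R n) (GL_mx_unit A) (@GL_mx_continuous R n A)).
Qed.

Lemma GL_inv_continuous n : continuous (fun A : GL R n => (A^-1)%g).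
Proof.
move=> A; apply: (@cvg_to_GL n _ (nbhs A) (nbhs_filter A) (fun B => (B^-1)%g) (A^-1)%g).
exact: cvg_GL_inv.
Qed.

Lemma cvgr0_of_norm_lt (T : Type) (F : set_system T) (FF : Filter F)
    (f : T -> R) :
  (forall e, 0 < e -> \forall t \near F, `|f t| < e) -> f @ F --> (0 : R).
Proof. by move=> H; apply/cvgr0Pnorm_lt. Qed.

End Continuity.

HB.instance Definition _ (R : realType) (n : nat) :=
  isTopologicalGroup.Build (GL R n)
    (@GL_mul_continuous R n) (@GL_inv_continuous R n).

Section OnePointCompactification.
Variables (R : realType) (n : nat).

Definition Xn : Type := one_point_compactification 'cV[R]_n.
HB.instance Definition _ := Topological.on Xn.

(* [Some v] is the vector v and [None] is the point at infinity. *)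
Definition GL_act (A : GL R n) (x : Xn) : Xn :=
  if x is Some v then Some (GL_mx A *m v) else None.

Fact GL_act1 (x : Xn) : GL_act 1%g x = x.
Proof. by case: x => // v; congr Some; exact: mul1mx. Qed.

Fact GL_actM (A B : GL R n) (x : Xn) :
  GL_act (A * B)%g x = GL_act A (GL_act B x).
Proof. by case: x => // v; congr Some; exact/esym/mulmxA. Qed.

Definition box (r : R) : set 'cV[R]_n := [set v | forall i, `|v i 0| <= r].

Lemma compact_box r : compact (box r).
Proof.
have cI : compact [set v : 'rV[R]_n | forall i, `[- r, r]%classic (v 0 i)].
  apply: (@rV_compact R n (fun=> `[- r, r]%classic)) => i.
  exact: segment_compact.
have -> : box r = trmx @` [set v : 'rV[R]_n | forall i, `[- r, r]%classic (v 0 i)].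
  apply/seteqP; split => [v vr|_ [v vr <-] i] /=.
    exists v^T; last exact: trmxK.
    by move=> i; rewrite /= mxE in_itv /= -ler_norml.
  by rewrite mxE ler_norml; have := vr i; rewrite /= in_itv.
apply: continuous_compact => //; apply: continuous_subspaceT => v.
apply: (@cvg_mx _ _ _ _ (nbhs v) (nbhs_filter v) trmx v^T) => i j.
rewrite mxE; under eq_fun do rewrite mxE; exact: coord_continuous.
Qed.

Lemma closed_box r : closed (box r).
Proof.
have -> : box r = \bigcap_(i in [set: 'I_n])
    ((fun v : 'cV[R]_n => `|v i 0|) @^-1` [set x | x <= r]).
  by apply/seteqP; split => [v vr i _|v vr i]; [exact: vr | exact: vr].
apply: closed_bigI => i _; apply: closed_comp; last exact: closed_le.
move=> v _; apply: (@cvg_norm _ _ _ (nbhs v) (nbhs_filter v) (fun w : 'cV[R]_n => w i 0)).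
exact: coord_continuous.
Qed.

Lemma compact_sub_box (K : set 'cV[R]_n) : compact K -> exists r, K `<=` box r.
Proof.
move=> cK; have : forall i, exists r, forall v, K v -> `|v i 0| <= r.
  move=> i; have : compact ((fun v : 'cV[R]_n => v i 0) @` K).
    apply: continuous_compact => //; apply: continuous_subspaceT.
    exact: coord_continuous.
  move=> /compact_bounded [M [_ HM]]; exists (M + 1) => v Kv.
  by apply: (HM (M + 1)); [rewrite ltrDl | exists v].
move=> /choice [r Hr]; exists (\sum_i `|r i|) => v Kv i.
rewrite (le_trans (Hr _ _ Kv))// (le_trans (ler_norm _))//.
by rewrite (bigD1 i)//= lerDl sumr_ge0.
Qed.

Lemma nbhs_infty_box r : \forall x \near (None : Xn),
  if x is Some v then ~ box r v else True.
Proof.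
exists (box r); first by split; [exact: compact_box | exact: closed_box].
by move=> _ [[v vr <-]|->].
Qed.

Lemma nbhs_inftyP (U : set Xn) : nbhs (None : Xn) U ->
  exists r, forall x : Xn, (if x is Some v then ~ box r v else True) -> U x.
Proof.
case=> K [cK _] KU; have [r Kr] := compact_sub_box cK.
exists r => -[v|] vr; apply: KU; last by right.
by left; exists v => //; exact/(contra_not _ vr)/Kr.
Qed.

Lemma GL_act_continuous :
  continuous (fun p : GL R n * Xn => GL_act p.1 p.2).
Proof.
case=> A [v|]; last first.
  move=> U /nbhs_inftyP[r rU].
  have [c Hc] := @cvg_entry_bound _ _ _ _ (nbhs A) (nbhs_filter A) _ _
    (@cvg_GL_inv R n A).
  exists ([set B : GL R n | forall i j, `|invmx (GL_mx B) i j| <= c],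
      [set x : Xn | if x is Some v then ~ box (n%:R * (c * r)) v else True]).
    by split => //=; exact: nbhs_infty_box.
  move=> [B x] [/= Bc xr]; apply: rU; case: x xr => //= v; apply: contra_not.
  move=> Bvr i.
  have -> : v = invmx (GL_mx B) *m (GL_mx B *m v).
    by rewrite mulmxA mulVmx ?mul1mx// (GL_mx_unit B).
  rewrite mxE (le_trans (ler_norm_sum _ _ _))//.
  rewrite -[n in n%:R]card_ord mulr_natl -sumr_const ler_sum// => j _.
  by rewrite normrM ler_pM// Bvr.
apply: (@cvg_comp _ _ _ (fun p => GL_act p.1 p.2) id); last exact: cvg_id.
move=> U /= HU.
have : (fun p : GL R n * 'cV[R]_n => GL_mx p.1 *m p.2) @ (A, v) --> GL_mx A *m v.
  apply: cvg_mulmx; last exact: cvg_snd.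
  by apply: (@cvg_comp _ _ _ fst GL_mx); [exact: cvg_fst | exact: GL_mx_continuous].
move=> /(_ _ HU) [[P Q] [/= PA Qv] PQ].
exists (P, Some @` Q); first by split => //; exact: one_point_compactification_some_nbhs.
by move=> [B x] [/= PB [w Qw <-]]; exact: (PQ (B, w)).
Qed.

(* The coordinates of [Xn] under the embedding into [R * R ^ n] sending
   infinity to 0 and v to (u, u ^+ 2 *: v), where u = 1 / (1 + |v|_1). *)
Definition Xn_scale (x : Xn) : R :=
  if x is Some v then (1 + \sum_i `|v i 0|)^-1 else 0.
Definition Xn_coord (i : 'I_n) (x : Xn) : R :=
  if x is Some v then Xn_scale (Some v) ^+ 2 * v i 0 else 0.
Definition Xn_dist (x y : Xn) : R :=
  `|Xn_scale x - Xn_scale y| + \sum_i `|Xn_coord i x - Xn_coord i y|.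

Let den_gt0 (v : 'cV[R]_n) : 0 < 1 + \sum_i `|v i 0|.
Proof. by rewrite ltr_pwDl// sumr_ge0. Qed.

Lemma Xn_scale_gt0 v : 0 < Xn_scale (Some v).
Proof. by rewrite invr_gt0. Qed.

Lemma Xn_coord_le i v : `|Xn_coord i (Some v)| <= Xn_scale (Some v).
Proof.
rewrite /Xn_coord normrM normrX (gtr0_norm (Xn_scale_gt0 v)) expr2 -mulrA.
rewrite ger_pMr ?Xn_scale_gt0// /= mulrC ler_pdivrMr// mul1r.
by rewrite (bigD1 i)//= addrCA lerDl addr_ge0 ?sumr_ge0.
Qed.

Let cvg_scale (T : Type) (F : set_system T) (FF : Filter F)
    (f : T -> 'cV[R]_n) (v : 'cV[R]_n) : f @ F --> v ->
  (fun t => Xn_scale (Some (f t))) @ F --> Xn_scale (Some v).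
Proof.
move=> fv; apply: cvgV; first by rewrite gt_eqF.
apply: cvgD; first exact: cvg_cst.
by apply: cvg_sumr => i; apply: cvg_norm; exact: cvg_coord.
Qed.

Let cvg_Xn_coord (T : Type) (F : set_system T) (FF : Filter F)
    (f : T -> 'cV[R]_n) (v : 'cV[R]_n) i : f @ F --> v ->
  (fun t => Xn_coord i (Some (f t))) @ F --> Xn_coord i (Some v).
Proof.
move=> fv; apply: cvgM; last exact: cvg_coord.
by rewrite expr2; under eq_fun do rewrite expr2; apply: cvgM; exact: cvg_scale.
Qed.

Lemma Xn_scale_near_infty (e : R) : 0 < e ->
  \forall x \near (None : Xn), Xn_scale x < e.
Proof.
move=> e0; apply: filterS (nbhs_infty_box e^-1) => -[v|//] /= /existsNP[i].
move=> /negP; rewrite -ltNge => vi.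
rewrite -[ltRHS]invrK ltf_pV2 ?posrE ?invr_gt0// (lt_le_trans vi)//.
by rewrite (bigD1 i)//= addrCA lerDl addr_ge0 ?sumr_ge0.
Qed.

Lemma Xn_scale_ge0 x : 0 <= Xn_scale x.
Proof. by case: x => [v|//]; exact/ltW/Xn_scale_gt0. Qed.

Lemma Xn_scale_continuous : continuous Xn_scale.
Proof.
case=> [v|]; first exact: (@cvg_scale _ (nbhs v) (nbhs_filter v) id v cvg_id).
apply: (@cvgr0_of_norm_lt R _ _ (nbhs_filter (None : Xn))) => e e0.
apply: (@filterS _ _ (nbhs_filter (None : Xn)) _ _ _ (Xn_scale_near_infty e0)) => x.
by rewrite ger0_norm ?Xn_scale_ge0.
Qed.

Lemma Xn_coord_continuous i : continuous (Xn_coord i).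
Proof.
case=> [v|].
  exact: (@cvg_Xn_coord _ (nbhs v) (nbhs_filter v) id v i cvg_id).
apply: (@cvgr0_of_norm_lt R _ _ (nbhs_filter (None : Xn))) => e e0.
apply: (@filterS _ _ (nbhs_filter (None : Xn)) _ _ _ (Xn_scale_near_infty e0)) => x.
by apply: le_lt_trans; case: x => [v|]; [exact: Xn_coord_le | rewrite normr0].
Qed.

Lemma Xn_dist_continuous x : continuous (Xn_dist x).
Proof.
move=> y.
have cX (f : Xn -> R) : continuous f ->
    (fun z => `|f x - f z|) @ y --> `|f x - f y|.
  move=> cf; apply: (@cvg_norm _ _ _ (nbhs y) (nbhs_filter y) (fun z => f x - f z)).
  by apply: (@cvgB _ _ _ (nbhs y) (nbhs_filter y) (fun=> f x) f);
    [exact: cvg_cst | exact: cf].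
apply: (@cvgD _ _ _ (nbhs y) (nbhs_filter y)
  (fun z => `|Xn_scale x - Xn_scale z|)); first exact/cX/Xn_scale_continuous.
apply: (@cvg_sumr R _ (nbhs y) (nbhs_filter y)) => i.
exact/cX/Xn_coord_continuous.
Qed.

Lemma Xn_dist_is_metric : is_metric Xn_dist.
Proof.
split=> [x y|x y|x y|x y z].
- by rewrite addr_ge0// sumr_ge0.
- split=> [|->]; last first.
    by rewrite /Xn_dist subrr normr0 add0r big1// => i _; rewrite subrr normr0.
  move/eqP; rewrite paddr_eq0// ?sumr_ge0// normr_eq0 subr_eq0.
  move=> /andP[/eqP sE]; rewrite psumr_eq0// => /allP cE.
  have {}cE i : Xn_coord i x = Xn_coord i y.
    have := cE i (mem_index_enum i).
    by rewrite /= normr_eq0 subr_eq0 => /eqP.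
  case: x y sE cE => [v|] [w|] sE cE //.
  + congr Some; apply/colP => i; have := cE i; rewrite /Xn_coord -sE.
    by apply: mulfI; rewrite expf_neq0// gt_eqF// Xn_scale_gt0.
  + by have := Xn_scale_gt0 v; rewrite sE ltxx.
  + by have := Xn_scale_gt0 w; rewrite -sE ltxx.
- by congr (_ + _); [rewrite distrC | apply: eq_bigr => i _; rewrite distrC].
- rewrite addrACA -big_split /= lerD ?ler_distD//.
  by apply: ler_sum => i _; exact: ler_distD.
Qed.

Lemma Xn_metrizable : metrizable R Xn.
Proof.
exists Xn_dist; split; first exact: Xn_dist_is_metric.
have [d0 dP ds dt] := Xn_dist_is_metric.
move=> x U; split=> [|[e e0 eU]]; last first.
  apply: (@filterS _ _ (nbhs_filter x) _ _ eU).
  apply: (@cvgr_lt _ _ _ (nbhs_filter x) _ _ (@Xn_dist_continuous x x)).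
  by rewrite (dP x x).2.
rewrite nbhsE => -[V [oV Vx] VU].
have /compact_near_coveringP : compact (~` V : set Xn).
  apply: (subclosed_compact _ one_point_compactification_compact) => //.
  exact: open_closedC.
move=> /(_ R 0^'+ (fun e y => e <= Xn_dist x y)).
have F : Filter (0^'+ : set_system R) by exact: filter_filter.
move=> /(_ F) cov.
have P : \forall e \near 0^'+, ~` V `<=` (fun y => e <= Xn_dist x y).
  apply: cov => y /= Vy.
  have dxy : 0 < Xn_dist x y.
    rewrite lt_neqAle d0 andbT eq_sym.
    by apply/eqP => /dP xy; apply: Vy; rewrite -xy.
  have dxy2 : 0 < Xn_dist x y / 2 by rewrite divr_gt0.
  near=> z e => /=; apply: (@le_trans _ _ (Xn_dist x y / 2)).
    near: e; exact: nbhs_right_le.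
  near: z.
  apply: (@cvgr_ge _ _ _ (nbhs_filter y) _ _ (@Xn_dist_continuous x y)).
  by rewrite ltr_pdivrMr// ltr_pMr// ltr1n.
near (0 : R)^'+ => e; exists e; first by near: e; exact: nbhs_right_gt.
move=> y /= dye; apply: VU; apply: contrapT => Vy.
suff eP : ~` V `<=` (fun z => e <= Xn_dist x z).
  by have := eP _ Vy; rewrite leNgt dye.
by near: e; exact: P.
Unshelve. all: by end_near. Qed.

End OnePointCompactification.

Definition GL_system (R : realType) (n : nat) : dynamical_system R :=
  @DynamicalSystem R (GL R n) (Xn R n)
    (@one_point_compactification_compact 'cV[R]_n)
    (@Xn_metrizable R n) (@GL_act R n)
    (@GL_act1 R n) (@GL_actM R n) (@GL_act_continuous R n).

(* Main.v *)
Require Import Defs.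
From HB Require Import structures.
From mathcomp Require Import all_boot all_order all_algebra.
From mathcomp Require Import all_classical all_reals all_analysis.
From mathcomp Require Import lra.

Import Order.TTheory GRing.Theory Num.Theory.
Import numFieldNormedType.Exports.

Local Open Scope classical_set_scope.
Local Open Scope ring_scope.

(** Tameness.  If every sequence in the acting group has a subsequence along
    which the action converges at every point, the system is tame
    ([tame_of_subseq_cvg]): by compactness an independent sequence contains, for
    each set of indices, a point on which it is small exactly on that set and
    large off it, so some point makes a given subsequence oscillate.  For
    matrices [A k] such a subsequence exists ([GL_act_subseq_cvg]): consider the
    subspace [U] of vectors on which [A k] converges.  If some [v] outside [U]
    is not sent to infinity, then [A k *m v] has a finite cluster point, and a
    subsequence realizing it converges on the larger subspace [U + <[v]>].  The
    dimension bounds the number of such enlargements, and when none is possible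
    every vector outside [U] is sent to infinity.

    Failure of first countability.  For an idempotent matrix [P], the matrices
    [P + k (1 - P)] converge pointwise to the map [e_P] which fixes the image of
    [P] and sends everything else to infinity, so [e_P] is in the enveloping
    semigroup ([idempotent_limit_enveloping]).  In dimension at least 2 there
    are uncountably many lines [L_t] through the origin, [t] a real number; let
    [P_t] project onto [L_t].  A nonzero vector lies on at most one [L_t], so
    at each point the values of [e_(P_t)] and [e_0] agree for all but at most
    one [t]: every neighborhood of [e_0] contains all but finitely many of the
    [e_(P_t)].  With a countable base at [e_0], a single [e_(P_t)] would then
    lie in every neighborhood of [e_0] ([first_countable_cofinite]), whereas
    [e_(P_t)] fixes the points of [L_t] and [e_0] sends the nonzero ones to
    infinity. *)

(** * Subsequences and cluster points *)

Lemma cvg_increasing_seq (f : nat -> nat) : increasing_seq f -> f @ \oo --> \oo.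
Proof.
move=> fi; have fge k : (k <= f k)%N.
  by elim: k => // k /leq_ltn_trans; apply; move/increasing_seqP: fi; exact.
by move=> A [N _ NA]; exists N => // k /= Nk; apply/NA/(leq_trans Nk).
Qed.

Lemma cvg_subseq {T : topologicalType} {u : nat -> T} {f : nat -> nat} {a : T} :
  increasing_seq f -> u @ \oo --> a -> u \o f @ \oo --> a.
Proof. by move=> /cvg_increasing_seq; exact: cvg_comp. Qed.

Lemma metrizable_first_countable (R : realType) (X : topologicalType) :
  metrizable R X -> first_countable X.
Proof.
move=> [d [_ dE]] x; exists (fun k => [set y | d x y < k.+1%:R^-1]).
split=> [k|U /dE[e e0 eU]]; first by apply/dE; exists k.+1%:R^-1.
have := @near_infty_natSinv_lt R (PosNum e0) => -[N _ /(_ N (leqnn N)) /= Ne].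
by exists N => y /= /lt_trans yN; apply/eU/yN.
Qed.

(** Choosing indices one after the other inside a decreasing base of
    neighborhoods of the cluster point. *)
Lemma cluster_subseq {T : topologicalType} {u : nat -> T} {a : T} :
  first_countable T -> cluster (u @ \oo) a ->
  exists2 f : nat -> nat, increasing_seq f & u \o f @ \oo --> a.
Proof.
move=> /(_ a)[B [nB BU]] clu.
(* A decreasing base, from the given base [B]. *)
pose C k := [set y | forall i : 'I_k.+1, B i y].
have nC k : nbhs a (C k).
  by apply: filter_forall => i; exact: nB.
have /choice[g gP] : forall kN : nat * nat,
    exists M, (kN.2 < M)%N /\ C kN.1 (u M).
  move=> [k N] /=.
  have : (u @ \oo) (u @` [set M | (N < M)%N]).
    by exists N.+1 => // M /= NM; exists M.
  by move=> /clu /(_ (nC k))[_ [[M NM <-] CM]]; exists M.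
pose f := nat_rect (fun=> nat) (g (0, 0))%N (fun k N => g (k.+1, N)).
have fC k : C k (u (f k)).
  by case: k => [|k]; [exact: (gP (0, 0)%N).2 | exact: (gP (k.+1, f k)).2].
exists f; first by apply/increasing_seqP => k; exact: (gP (k.+1, f k)).1.
move=> U /BU[k BkU]; exists k => // m /= km; apply: BkU.
exact: (fC m (Ordinal (km : k < m.+1)%N)).
Qed.

(** A filter that does not converge to [a] meets the complement of some open
    neighborhood [V] of [a]; its trace there has a cluster point by compactness,
    and that point is again outside [V]. *)
Lemma compact_not_cvg {T : topologicalType} {F : set_system T}
    {FF : ProperFilter F} {a : T} : compact [set: T] -> ~ F --> a ->
  exists2 b, b <> a & cluster F b.
Proof.
move=> cT /existsNP[U /not_implyP[]]; rewrite nbhsE => -[V [oV Va] VU] nFU.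
have FV : ~ F V by move=> FV; apply: nFU; exact: filterS VU FV.
have pF : ProperFilter (within (~` V) F).
  apply: Build_ProperFilter_ex => A FA; apply: contrapT => /forallNP nA.
  apply/FV/(@filterS _ F _ (fun x => ~ V x -> A x)) => // x xA.
  apply: contrapT => nV.
  exact/(nA x)/xA.
have [|b [_ clb]] := cT (within (~` V) F) pF; first exact: filterT.
exists b.
  move=> ba; rewrite ba in clb.
  have nV : nbhs a V by exact: open_nbhs_nbhs.
  by have [x [nVx /nVx]] := clb (~` V) V (withinT _ _) nV.
by apply: cvg_cluster clb => A; exact: (@filterS _ F).
Qed.

(** * Convergence in initial and pointwise topologies *)

Lemma cvg_initial {S : choiceType} {T : topologicalType} {f : S -> T} {I : Type}
    {F : set_system I} {FF : Filter F} {u : I -> S} (s : S) :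
  f \o u @ F --> f s -> u @ F --> (s : initial_topology f).
Proof.
move=> ufs U /= [_ [[W oW <-] /= Ws WU]].
have : nbhs (f s) W by exact: open_nbhs_nbhs.
by move=> /ufs; rewrite !nbhs_filterE /= => /filterS; apply=> t Wt; exact: WU.
Qed.

Lemma cvg_ptws {X Y : topologicalType} {I : Type} {F : set_system I}
    {FF : Filter F} {q : I -> X -> Y} {p : X -> Y} :
  (forall x, (fun t => q t x) @ F --> p x) ->
  (q : I -> {ptws X -> Y}) @ F --> (p : {ptws X -> Y}).
Proof.
move=> qp; apply/cvg_sup => x.
exact: (@cvg_initial (X -> Y) _ (fun h => h x) I F FF q p (qp x)).
Qed.

(** * Tameness from pointwise convergent subsequences *)

(** Independence gives points only for finite sets of indices and strict
    inequalities.  A cluster point of the points found for the initial segments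
    serves all indices at once, and the inequalities survive as closed
    conditions. *)
Lemma independent_closed {X : topologicalType} {R : realType}
    {g : nat -> X -> R} : compact [set: X] -> (forall k, continuous (g k)) ->
  independent_seq g ->
  exists a b : R, a < b /\ forall E : set nat, exists x,
    (forall k, E k -> g k x <= a) /\ (forall k, ~ E k -> b <= g k x).
Proof.
move=> cX cg [a [b [ab ind]]]; exists a, b; split=> // E.
have /choice[x xP] : forall N, exists x, forall k, (k < N)%N ->
    (E k -> g k x < a) /\ (~ E k -> b < g k x).
  move=> N.
  have fin (D : set nat) : finite_set ([set k | (k < N)%N] `&` D).
    exact/finite_setIl/finite_II.
  have [|x [xP xM]] := ind _ _ (fin E) (fin (~` E)).
    by rewrite setIACA setICr setI0.
  by exists x => k kN; split=> Ek; [exact: xP | exact: xM].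
have [|y [_ cly]] := cX (x @ \oo) _; first exact: filterT.
have lim k (D : set R) : closed D ->
    (forall N, (k < N)%N -> D (g k (x N))) -> D (g k y).
  move=> cD DN; apply: (preimage_closed _ cD) => [z _|]; first exact: cg.
  rewrite closureEcluster.
  apply: cvg_cluster cly => A AD.
  by exists k.+1 => // N /= kN; apply: AD; exact: DN.
exists y; split=> k Ek.
  apply: (lim k [set r | r <= a]); first exact: closed_le.
  by move=> N /xP[+ _] => /(_ Ek)/ltW.
apply: (lim k [set r | b <= r]); first exact: closed_ge.
by move=> N /xP[_] => /(_ Ek)/ltW.
Qed.

(** Independence provides a point at which [f] along the subsequence is at most
    [a] at even steps and at least [b > a] at odd steps, so that it cannot
    converge. *)
Lemma tame_of_subseq_cvg {R : realType} (S : dynamical_system R) :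
  (forall t : nat -> ds_group S, exists2 phi : nat -> nat, increasing_seq phi &
    forall x, exists y : ds_space S,
      (fun k => ds_act (t (phi k)) x) @ \oo --> y) ->
  tame S.
Proof.
move=> seqS f cf [g [gact ind]].
have /choice[t tg] k : exists t, f \o ds_act t = g k.
  by have [t _ <-] := gact k; exists t.
have [phi phii phic] := seqS t.
have cg k : continuous (g k).
  rewrite -tg => x; apply: continuous_comp; last exact: cf.
  apply: (@continuous_comp _ _ _ (fun x => (t k, x))
    (fun p : ds_group S * ds_space S => ds_act p.1 p.2)).
    by apply: cvg_pair; [exact: cvg_cst | exact: cvg_id].
  exact: ds_act_continuous.
have [a [b [ab ghit]]] := independent_closed (@ds_compact _ S) cg ind.
(* The index set is the image of the even numbers, so that evenness of [k]
   decides on which side the value at [phi k] lies. *)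
have [x [xa xb]] := ghit [set phi k | k in [set k | ~~ odd k]].
have [y xy] := phic x.
have gy : (fun k => g (phi k) x) @ \oo --> f y.
  under eq_fun do rewrite -tg.
  by apply: cvg_comp xy _; exact: cf.
have [N _ yN] : \forall k \near \oo, `|f y - g (phi k) x| < (b - a) / 2.
  by move/cvgrPdist_lt: gy; apply; rewrite divr_gt0 ?subr_gt0.
have := yN N.*2; have := yN N.*2.+1.
rewrite /= -addnn leq_addr -addnS leq_addr addnS addnn.
move=> /(_ isT) y1 /(_ isT) y2.
have : g (phi N.*2) x <= a.
  by apply: xa; exists N.*2; rewrite //= odd_double.
have : b <= g (phi N.*2.+1) x.
  apply: xb => -[k /= ke /(increasing_seq_injective phii) kN].
  by move: ke; rewrite kN /= odd_double.
by move: y1 y2; rewrite !ltr_distl; lra.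
Qed.

(** * Sequences of invertible matrices *)

Lemma cvg_someP {R : realType} {n : nat} {I : Type} {F : set_system I}
    {FF : Filter F} (v : I -> 'cV[R]_n) (w : 'cV[R]_n) :
  (fun t => Some (v t) : Xn R n) @ F --> (Some w : Xn R n) <-> v @ F --> w.
Proof.
split=> [vw U /one_point_compactification_some_nbhs/vw|vw U /vw//].
by rewrite !nbhs_filterE /= => /filterS; apply=> t [_ /[swap] [[->]]].
Qed.

(** Limits are produced by enlarging the subspace on which the sequence already
    converges; the auxiliary [m] bounds the number of enlargements left.  A
    subspace that cannot be enlarged has all other vectors sent to infinity. *)
Lemma GL_act_subseq_cvg {R : realType} {n : nat} (A : nat -> GL R n) :
  exists2 phi : nat -> nat, increasing_seq phi &
    forall x : Xn R n, exists y : Xn R n,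
      (fun k => GL_act (A (phi k)) x) @ \oo --> y.
Proof.
have dimU (U : {vspace 'cV[R]_n}) : (\dim U <= n)%N.
  by have := dimvS (subvf U); rewrite dimvf dim_matrix mulr1.
suff extend m (U : {vspace 'cV[R]_n}) (B : nat -> GL R n) :
    (n < \dim U + m)%N ->
    (forall u, u \in U ->
       exists w : 'cV[R]_n, (fun k => GL_mx (B k) *m u) @ \oo --> w) ->
    exists2 phi : nat -> nat, increasing_seq phi &
      forall x : Xn R n, exists y : Xn R n,
        (fun k => GL_act (B (phi k)) x) @ \oo --> y.
  have [||phi] := extend n.+1 0%VS A; [by rewrite ltn_addl | | by exists phi].
  move=> u; rewrite memv0 => /eqP ->; exists 0.
  by under eq_fun do rewrite mulmx0; exact: cvg_cst.
elim: m U B => [|m IH] U B; first by rewrite addn0 ltnNge dimU.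
move=> nU cvU.
have [out|/existsNP[v /not_implyP[vU nv]]] := pselect (forall v, v \notin U ->
    (fun k => Some (GL_mx (B k) *m v) : Xn R n) @ \oo --> (None : Xn R n)).
  exists id => // -[v|]; last by exists None; exact: cvg_cst.
  have [/cvU[w vw]|/out vU] := boolP (v \in U); last by exists None.
  by exists (Some w); exact/cvg_someP.
have [[w|//] _ clw] :=
  compact_not_cvg (@one_point_compactification_compact 'cV[R]_n) nv.
have [phi phii /cvg_someP phiw] := cluster_subseq
  (@metrizable_first_countable R _ (@Xn_metrizable R n)) clw.
have [||psi psii psic] := IH (U + <[v]>)%VS (B \o phi).
- apply: (leq_trans nU); rewrite addnS -addSn leq_add2r.
  rewrite ltn_neqAle (dimv_leqif_sup (addvSl _ _)).1 andbT.
  rewrite (dimv_leqif_sup (addvSl _ _)).2; apply: contra vU => /subvP; apply.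
  by rewrite -{1}[v]add0r memv_add ?mem0v ?memv_line.
- move=> _ /memv_addP[u /cvU[w' uw'] [_ /vlineP[c ->] ->]].
  exists (w' + c *: w).
  have -> : (fun k => GL_mx ((B \o phi) k) *m (u + c *: v)) =
      (fun k => GL_mx (B (phi k)) *m u) +
      (fun k => c *: (GL_mx (B (phi k)) *m v)).
    by apply/funext => k /=; rewrite mulmxDr -scalemxAr.
  apply: cvgD; first exact: (cvg_subseq phii uw').
  exact: cvgZl_tmp.
- by exists (phi \o psi) => // i j; rewrite /= phii -leEnat psii.
Qed.

(** * Uncountable families converging along the cofinite filter *)

Definition cofinite (I : Type) : set_system I := [set A | cofinite_set A].

#[global] Instance cofinite_filter (I : Type) : Filter (cofinite I).
Proof.
split=> [|A B cA cB|A B AB]; first exact: cofinite_setT.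
- by rewrite /cofinite /= cofinite_setI.
- exact: sub_cofinite_set.
Qed.

(** Each member of a countable base misses finitely many of the [q t], so all of
    them together miss countably many. *)
Lemma first_countable_cofinite {Y : topologicalType} {I : Type} {q : I -> Y}
    {p : Y} : first_countable Y -> ~ countable [set: I] ->
  q @ cofinite I --> p ->
  exists t, forall U, nbhs p U -> U (q t).
Proof.
move=> /(_ p)[B [nB BU]] nI cof; apply: contrapT => /forallNP no; apply: nI.
have : countable (\bigcup_k (~` (q @^-1` B k))).
  by apply: bigcup_countable => // k _; exact/finite_set_countable/cof.
apply: sub_countable; apply: subset_card_le => t _.
have /existsNP[U /not_implyP[/BU[k BkU] nUt]] := no t.
by exists k => // /BkU.
Qed.

Lemma uncountable_real (R : realType) : ~ countable [set: R].
Proof.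
move=> cR.
have /countable_lebesgue_measure0 : countable `[0, 1 : R]%classic.
  by apply: sub_countable cR; exact: subset_card_le.
by rewrite lebesgue_measure_itv /= lte_fin ltr01 oppr0 adde0 => -[] /eqP;
  rewrite oner_eq0.
Qed.

(** * Maps of the enveloping semigroup attached to idempotent matrices *)

Section EnvelopingSemigroup.
Context {R : realType} {n : nat}.

Definition idempotent_limit (P : 'M[R]_n) (x : Xn R n) : Xn R n :=
  if x is Some v then if P *m v == v then x else None else None.

(** The inverse dilates by [c^-1]: [P] and [1 - P] are complementary
    idempotents. *)
Lemma idempotent_dilation_unit {P : 'M[R]_n} {c : R} : P *m P = P -> c != 0 ->
  P + c *: (1%:M - P) \in unitmx.
Proof.
move=> PP c0; apply: (proj1 (@mulmx1_unit _ _ _ (P + c^-1 *: (1%:M - P)) _)).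
rewrite mulmxDl !mulmxDr -!scalemxAl -!scalemxAr scalerA mulfV// scale1r.
rewrite !mulmxBl !mulmxBr !mul1mx !mulmx1 PP subrr !scaler0.
by rewrite addr0 add0r subr0 addrC subrK.
Qed.

(** The image of [v] is [P v + k (v - P v)], and some coordinate of [v - P v] is
    nonzero. *)
Lemma cvg_dilation_infty (P : 'M[R]_n) (v : 'cV[R]_n) : P *m v != v ->
  (fun k => Some ((P + k.+1%:R *: (1%:M - P)) *m v) : Xn R n) @ \oo -->
  (None : Xn R n).
Proof.
rewrite eq_sym -subr_eq0 => z0 U /nbhs_inftyP[r rU].
have [i zi] : exists i, (v - P *m v) i 0 != 0.
  by apply/existsP; apply: contraNT z0 => /existsPn z; apply/eqP/colP => i;
    rewrite [RHS]mxE; apply/eqP/negPn.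
have zi0 : 0 < `|(v - P *m v) i 0| by rewrite normr_gt0.
have : \forall k \near \oo,
    (r + `|(P *m v) i 0|) / `|(v - P *m v) i 0| < k%:R :> R.
  exact: nbhs_infty_gtr.
apply: filterS => k kr; apply: rU => /(_ i); apply/negP; rewrite -ltNge.
have -> : ((P + k.+1%:R *: (1%:M - P)) *m v) i 0 =
    k.+1%:R * (v - P *m v) i 0 - (- (P *m v) i 0).
  by rewrite mulmxDl -scalemxAl mulmxBl mul1mx opprK addrC mxE [X in X + _]mxE.
apply: lt_le_trans (lerB_dist _ _); rewrite normrN ltrBrDr normrM.
rewrite -ltr_pdivrMr// (lt_le_trans kr)// normr_nat ler_nat; exact: leqnSn.
Qed.

(** [idempotent_limit P] is the pointwise limit of [P + k (1 - P)]: this matrix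
    fixes the vectors fixed by [P], and moves the others to infinity. *)
Lemma idempotent_limit_enveloping {P : 'M[R]_n} : P *m P = P ->
  enveloping_semigroup (GL_system R n) (idempotent_limit P).
Proof.
move=> PP.
(* The dilation factor is [k.+1], so that it is nonzero for all [k]. *)
pose A k : GL R n :=
  exist (fun A => A \in unitmx) _
    (idempotent_dilation_unit PP (lt0r_neq0 (ltr0Sn R k))).
have AP : (fun k => GL_act (A k) : {ptws Xn R n -> Xn R n}) @ \oo -->
    (idempotent_limit P : {ptws Xn R n -> Xn R n}).
  apply: cvg_ptws => -[v|]; last exact: cvg_cst.
  rewrite /=; case: ifPn => [/eqP Pv|]; last exact: cvg_dilation_infty.
  have -> : (fun k => Some (GL_mx (A k) *m v) : Xn R n) = fun=> Some v.
    apply/funext => k; congr Some.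
    by rewrite mulmxDl -scalemxAl mulmxBl mul1mx Pv subrr scaler0 addr0.
  exact: cvg_cst.
move=> U /AP [N _ /(_ N (leqnn N)) NU].
by exists (GL_act (A N)); split => //; exists (A N).
Qed.

Lemma nbhs_infty_neq (w : 'cV[R]_n) :
  \forall x \near (None : Xn R n), x <> Some w.
Proof.
have [r wr] := compact_sub_box (@compact_set1 _ w).
apply: filterS (@nbhs_infty_box R n r) => x /[swap] -> /=; apply.
exact: wr.
Qed.

End EnvelopingSemigroup.

(** * The pencil of lines in a coordinate plane *)

Definition slope_vec {R : realType} {n : nat} (i0 i1 : 'I_n) (t : R) :
    'cV[R]_n :=
  delta_mx i0 0 + t *: delta_mx i1 0.

(** The projection onto the line of slope [t] whose kernel is the hyperplane
    where the coordinate [i0] vanishes. *)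
Definition line_proj {R : realType} {n : nat} (i0 i1 : 'I_n) (t : R) :
    'M[R]_n :=
  slope_vec i0 i1 t *m delta_mx 0 i0.

Section LineProjection.
Context {R : realType} {n : nat} {i0 i1 : 'I_n} (i01 : i1 != i0).

Local Notation slope_vec := (slope_vec i0 i1).
Local Notation line_proj := (line_proj i0 i1).

Lemma line_projE (t : R) (v : 'cV[R]_n) :
  line_proj t *m v = v i0 0 *: slope_vec t.
Proof.
rewrite /line_proj -mulmxA -rowE; apply/colP => j.
by rewrite !mxE big_ord1 !mxE mulrC.
Qed.

Lemma slope_vec0 (t : R) : slope_vec t i0 0 = 1.
Proof. by rewrite !mxE !eqxx [i0 == i1]eq_sym (negbTE i01) mulr0 addr0. Qed.

Lemma slope_vec1 (t : R) : slope_vec t i1 0 = t.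
Proof. by rewrite !mxE !eqxx (negbTE i01) mulr1 add0r. Qed.

Lemma line_proj_idem (t : R) : line_proj t *m line_proj t = line_proj t.
Proof.
by rewrite {2}/(line_proj _) mulmxA line_projE slope_vec0 scale1r.
Qed.

Lemma line_proj_fixed {t : R} {v : 'cV[R]_n} : v != 0 -> line_proj t *m v = v ->
  t = v i1 0 / v i0 0.
Proof.
rewrite line_projE => v0 tv.
have vi0 : v i0 0 != 0.
  by apply: contraNneq v0 => vi; rewrite -tv vi scale0r.
by rewrite -[in v i1 0]tv mxE slope_vec1 mulrC mulKf.
Qed.

(** A nonzero vector is fixed by [line_proj t] for at most one [t], namely its
    slope. *)
Lemma cvg_line_proj_limit (x : Xn R n) :
  (fun t => idempotent_limit (line_proj t) x) @ cofinite R -->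
  idempotent_limit 0 x.
Proof.
case: x => [v|]; last exact: cvg_cst.
rewrite /= mul0mx; have [<-|v0] := eqVneq 0 v.
  by under eq_fun do rewrite mulmx0 eqxx; exact: cvg_cst.
move=> U nU.
apply: (@sub_finite_set _ _ [set v i1 0 / v i0 0]) (finite_set1 _) => t /=.
case: ifPn => [/eqP tv _|_ []]; last exact: (@nbhs_singleton (Xn R n)).
by apply: line_proj_fixed tv; rewrite eq_sym.
Qed.

End LineProjection.

(** * Failure of first countability *)

Lemma not_tame1_GL (R : realType) (n : nat) : (2 <= n)%N ->
  ~ tame1 (GL_system R n).
Proof.
move=> n2 fc.
pose i0 := Ordinal (ltnW n2); pose i1 := Ordinal n2.
have i01 : i1 != i0 by [].
pose E := enveloping_semigroup (GL_system R n).
pose q (t : R) : set_type E := exist (fun h => h \in E) _ (mem_set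
  (idempotent_limit_enveloping (line_proj_idem i01 t))).
pose p : set_type E := exist (fun h => h \in E) _ (mem_set
  (idempotent_limit_enveloping (mul0mx n (0 : 'M[R]_n)))).
(* [p] is the map fixing 0 and sending every nonzero vector to infinity. *)
have qp : q @ cofinite R --> p.
  by apply: cvg_initial; apply: cvg_ptws; exact: cvg_line_proj_limit.
have [t tp] := first_countable_cofinite fc (@uncountable_real R) qp.
pose w := slope_vec i0 i1 t.
(* Evaluation at [w] separates [p] from [q t]. *)
have : nbhs p [set h : set_type E | set_val h (Some w) <> Some w].
  have ev : continuous (fun h : set_type E => set_val h (Some w) : Xn R n).
    move=> h; apply: (@continuous_comp _ {ptws Xn R n -> Xn R n} _
      (set_val : set_type E -> _) (fun g => g (Some w))).
      exact: initial_continuous.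
    exact: (@proj_continuous _ (fun=> Xn R n) (Some w)).
  have pw : set_val p (Some w) = None.
    change (idempotent_limit (0 : 'M[R]_n) (Some w) = None).
    rewrite /= mul0mx; case: eqVneq => // /colP/(_ i0)/esym/eqP.
    by rewrite slope_vec0// mxE oner_eq0.
  apply: (ev p [set x | x <> Some w]); rewrite pw; exact: nbhs_infty_neq.
move=> /tp; apply.
change (idempotent_limit (line_proj i0 i1 t) (Some w) = Some w).
by rewrite /= line_projE slope_vec0// scale1r eqxx.
Qed.

Theorem theorem7p1 (R : realType) (n : nat) (hn : (1 <= n)%N) :
  tame (GL_system R n) /\ ((2 <= n)%N -> ~ tame1 (GL_system R n)).
Proof.
split; last exact: not_tame1_GL.
apply: tame_of_subseq_cvg; exact: GL_act_subseq_cvg.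
Qed.
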